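(* Let $(k,l) \in \{(1,1), (2,1), (3,2)\}$ and let $p,q$ be positive integers such that $kp$ and $lq$ are relatively prime. Then the triangles $\mathcal{T}_{\frac{q}{kp},\frac{p}{lq}}$ and $\mathcal{T}_{\frac{1}{k},\frac{1}{l}}$ are Ehrhart equivalent if and only if $$kp^2-(k+l+1)pq+lq^2+1=0.$$
   Context: For positive real numbers $u,v$, $\mathcal{T}_{u,v}\subset\mathbb{R}^2$ denotes the (closed, solid) triangle with vertices $(0,0)$, $(0,u)$ and $(v,0)$. For a rational polytope $\mathcal{P}\subset\mathbb{R}^d$, its Ehrhart quasipolynomial is the counting function $L_{\mathcal{P}}(t) = \#(\mathcal{P}\cap \frac{1}{t}\mathbb{Z}^d)$ for positive integers $t$. Two triangles $\mathcal{T},\mathcal{T}'$ are called Ehrhart equivalent if they have the same Ehrhart quasipolynomial, i.e. $L_{\mathcal{T}}(t)=L_{\mathcal{T}'}(t)$ for all positive integers $t$. *)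

(* Defs.v *)
From mathcomp Require Import all_boot all_order all_algebra.
From mathcomp Require Import finmap boolp classical_sets functions cardinality.
From mathcomp Require Import reals.

Set Implicit Arguments.
Unset Strict Implicit.
Unset Printing Implicit Defensive.

Import Order.TTheory GRing.Theory Num.Theory.
Local Open Scope classical_set_scope.
Local Open Scope ring_scope.

Definition point2 (R : realType) (x y : R) : 'rV[R]_2 :=
  \row_(i < 2) if i == ord0 then x else y.

Definition triangle (R : realType) (a b c : 'rV[R]_2) : set 'rV[R]_2 :=
  [set x | exists r s t : R, [/\ 0 <= r, 0 <= s, 0 <= t, r + s + t = 1 &
                                 x = r *: a + s *: b + t *: c]].

Definition right_triangle (R : realType) (u v : R) : set 'rV[R]_2 :=
  triangle (point2 0 0) (point2 0 u) (point2 v 0).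

Definition scaled_lattice (R : realType) (d t : nat) : set 'rV[R]_d :=
  [set t%:R^-1 *: map_mx intr z | z in [set: 'rV[int]_d]].
Arguments scaled_lattice R d t : clear implicits.

(* [fset_set] sends every infinite set to [fset0], so this counts points only
   when [P] meets the lattice in a finite set, as every bounded [P] does; see
   [finite_right_triangle_lattice]. *)
Definition ehrhart (R : realType) (d : nat) (P : set 'rV[R]_d) (t : nat) : nat :=
  #|` fset_set (P `&` scaled_lattice R d t) |.

Definition ehrhart_equivalent (R : realType) (d : nat) (P Q : set 'rV[R]_d) :
    Prop :=
  forall t : nat, (0 < t)%N -> ehrhart P t = ehrhart Q t.

Lemma finite_right_triangle_lattice (R : realType) (u v : R) (t : nat) :
  0 < u -> 0 < v -> (0 < t)%N ->
  finite_set (right_triangle u v `&` scaled_lattice R 2 t).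
Proof.
move=> u0 v0 t0.
pose B := t%:R * (u + v).
have t0R : 0 < t%:R :> R by rewrite ltr0n.
pose N := (Num.truncn B).+1.
apply: (@sub_finite_set _ _ [set (t%:R^-1 : R) *: map_mx intr
    (\row_i Posz (f i)) | f in [set: {ffun 'I_2 -> 'I_N}]]); last first.
  exact/finite_image/finite_finset.
move=> x [[r [s [w [r0 s0 w0 rsw xE]]]] [z _ zE]].
have s1 : s <= 1 by rewrite -rsw addrAC lerDr addr_ge0.
have w1 : w <= 1 by rewrite -rsw lerDr addr_ge0.
have zi i : 0 <= ((z 0 i)%:~R : R) <= B.
  have -> : (z 0 i)%:~R = t%:R * x 0 i :> R.
    by rewrite -zE !mxE mulrA mulfV ?gt_eqF// mul1r.
  rewrite pmulr_rge0// ler_pM2l// xE !mxE.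
  case: ifP => _; rewrite !mulr0 ?addr0 ?add0r.
    rewrite mulr_ge0 ?(ltW v0)//= (le_trans (ler_piMl (ltW v0) w1))//.
    by rewrite lerDr ltW.
  rewrite mulr_ge0 ?(ltW u0)//= (le_trans (ler_piMl (ltW u0) s1))//.
  by rewrite lerDl ltW.
have zN (i : 'I_2) : (`|z ord0 i| < N)%N.
  have /andP[z0 zB] := zi i; rewrite ler0z in z0.
  rewrite /N ltnS truncn_ge_nat ?natr_absz ?ger0_norm//.
  by rewrite mulr_ge0 ?addr_ge0// ltW.
exists [ffun i => Ordinal (zN i)] => //.
rewrite -zE; congr (_ *: map_mx _ _); apply/rowP => i; rewrite !mxE ffunE /=.
by have /andP[z0 _] := zi i; rewrite ler0z in z0; rewrite gez0_abs.
Qed.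

(* Main.v *)
(* The Ehrhart function of the triangle with legs s/(t b) and s/(t a), taken at
   t, is the number of (m, n) in N^2 with a m + b n <= s.

   If the triangles are equivalent, compare them at t = k l p q: both dilates
   are integral, their points are counted by the central symmetry of a
   rectangle, and equality of the two counts is the quadratic equation.

   Conversely, if the equation holds then so does k p p' = l q^2 + 1 for
   p' = (k + l + 1) q / k - p, which is an integer for these (k, l).  Shearing
   the part of the triangle cut off by a line through a vertex (a polygon
   mutation) is a lattice-preserving bijection onto the triangle of (p', q), and
   (p', q) solves the equation again.  Together with the symmetric move on q
   this descends to (p, q) = (1, 1). *)
Require Import Defs.
From mathcomp Require Import all_boot all_order all_algebra.
From mathcomp Require Import finmap boolp classical_sets functions cardinality.
From mathcomp Require Import reals zify ring.

Import Order.TTheory GRing.Theory Num.Theory.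
Local Open Scope classical_set_scope.
Local Open Scope ring_scope.
Local Open Scope card_scope.

Definition under_line (a b s : nat) : set (nat * nat) :=
  [set x | (a * x.1 + b * x.2 <= s)%N].

Lemma right_triangleP (R : realType) (u v : R) (x : 'rV[R]_2) :
  0 < u -> 0 < v ->
  right_triangle u v x <->
  [/\ 0 <= x 0 0, 0 <= x 0 1 & u * x 0 0 + v * x 0 1 <= u * v].
Proof.
move=> u0 v0; split.
  move=> [r [s [w [r0 s0 w0 rsw ->]]]]; rewrite !mxE /=.
  rewrite !mulr0 !addr0 !add0r.
  split; [by rewrite mulr_ge0// ltW|by rewrite mulr_ge0// ltW|].
  have -> : u * (w * v) + v * (s * u) = u * v * (1 - r) by rewrite -rsw; ring.
  by rewrite ler_piMr ?(ltW (mulr_gt0 u0 v0))// lerBlDr lerDl.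
move=> [x0 x1 h].
exists (1 - x 0 1 / u - x 0 0 / v), (x 0 1 / u), (x 0 0 / v).
have un : u != 0 by rewrite gt_eqF.
have vn : v != 0 by rewrite gt_eqF.
split; [|by rewrite divr_ge0// ltW|by rewrite divr_ge0// ltW|by ring|].
  have -> : 1 - x 0 1 / u - x 0 0 / v =
            (u * v - (u * x 0 0 + v * x 0 1)) / (u * v) by field; rewrite un vn.
  by rewrite divr_ge0 ?subr_ge0// ltW// mulr_gt0.
apply/rowP => i; rewrite !mxE; case: ifP => /= i0.
  by rewrite (eqP i0); field; rewrite un vn.
have -> : i = 1 by apply/val_inj; case: i i0 => -[|[]].
by field; rewrite un vn.
Qed.

Lemma right_triangle_lattice_card (R : realType) (a b s t : nat) :
  (0 < a)%N -> (0 < b)%N -> (0 < s)%N -> (0 < t)%N ->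
  right_triangle (s%:R / (t * b)%:R : R) (s%:R / (t * a)%:R)
    `&` scaled_lattice R 2 t #= under_line a b s.
Proof.
move=> a0 b0 s0 t0.
have aR : 0 < a%:R :> R by rewrite ltr0n.
have bR : 0 < b%:R :> R by rewrite ltr0n.
have sR : 0 < s%:R :> R by rewrite ltr0n.
have tR : 0 < t%:R :> R by rewrite ltr0n.
pose f (x : nat * nat) : 'rV[R]_2 :=
  t%:R^-1 *: map_mx intr (\row_i if i == 0 then x.1%:Z else x.2%:Z).
have finj : injective f.
  move=> [m n] [m' n'] /rowP fE.
  have := fE 0; have := fE 1; rewrite !mxE /= => e1 e0.
  have tn : t%:R^-1 != 0 :> R by rewrite invr_eq0 gt_eqF.
  by move: e0 e1 => /(mulfI tn)/(@intr_inj R)[->] /(mulfI tn)/(@intr_inj R)[->].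
suff -> : right_triangle (s%:R / (t * b)%:R : R) (s%:R / (t * a)%:R)
    `&` scaled_lattice R 2 t = f @` under_line a b s.
  by apply: inj_card_eq => x y _ _; apply: finj.
have key (m n : nat) : right_triangle (s%:R / (t * b)%:R : R)
    (s%:R / (t * a)%:R) (f (m, n)) <-> under_line a b s (m, n).
  rewrite right_triangleP ?divr_gt0 ?ltr0n ?muln_gt0 ?t0//.
  rewrite /under_line !mxE /= !natrM.
  (* A common positive factor separates the hypotenuse inequality from [a m + b n <= s]. *)
  have E : s%:R / (t%:R * b%:R) * (t%:R^-1 * m%:R) +
      s%:R / (t%:R * a%:R) * (t%:R^-1 * n%:R) =
      s%:R / (t%:R * b%:R * (t%:R * a%:R)) * (a%:R * m%:R + b%:R * n%:R) :> R.
    by field; rewrite !gt_eqF.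
  have -> : s%:R / (t%:R * b%:R) * (s%:R / (t%:R * a%:R)) =
      s%:R / (t%:R * b%:R * (t%:R * a%:R)) * s%:R :> R.
    by field; rewrite !gt_eqF.
  rewrite E ler_pM2l ?divr_gt0 ?mulr_gt0// -!natrM -natrD ler_nat.
  split=> [[]//|h]; split=> //;
    by apply: mulr_ge0; rewrite ?ler0z// invr_ge0 ltW.
apply/seteqP; split=> [x [Tx [z _ zE]]|x [[m n] mn <-]]; last first.
  split; first exact/key.
  by exists (\row_i if i == 0 then m%:Z else n%:Z).
have [z0 z1] : 0 <= z 0 0 /\ 0 <= z 0 1.
  have := Tx; rewrite right_triangleP ?divr_gt0 ?ltr0n ?muln_gt0 ?t0//.
  by rewrite -zE !mxE !pmulr_rge0 ?invr_gt0// !ler0z => -[].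
have xE : x = f (`|z 0%R 0%R|%N, `|z 0%R 1%R|%N).
  rewrite -zE /f; congr (_ *: map_mx _ _); apply/rowP => i; rewrite mxE /=.
  case: ifP => [/eqP ->|i0]; first by rewrite gez0_abs.
  have -> : i = 1 by apply/val_inj; case: i i0 => -[|[]].
  by rewrite gez0_abs.
by exists (`|z 0%R 0%R|%N, `|z 0%R 1%R|%N); rewrite -?xE//; apply/key;
  rewrite -xE.
Qed.

Lemma finite_under_line (a b s : nat) :
  (0 < a)%N -> (0 < b)%N -> finite_set (under_line a b s).
Proof.
move=> a0 b0; apply: (@sub_finite_set _ _ (`I_s.+1 `*` `I_s.+1)).
  by move=> [m n]; rewrite /under_line /= => h; split=> /=; nia.
exact/finite_setX/finite_II/finite_II.
Qed.

Lemma ehrhart_right_triangle (R : realType) (a b s t : nat) :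
  (0 < a)%N -> (0 < b)%N -> (0 < s)%N -> (0 < t)%N ->
  ehrhart (right_triangle (s%:R / (t * b)%:R : R) (s%:R / (t * a)%:R)) t =
  #|` fset_set (under_line a b s)|%fset.
Proof.
move=> a0 b0 s0 t0; apply/fcard_eq; last exact: right_triangle_lattice_card.
  by apply: finite_right_triangle_lattice => //;
    rewrite divr_gt0 ?ltr0n ?muln_gt0 ?t0.
exact: finite_under_line.
Qed.

(* The polygon mutation: a shear, fixing the line [k (p' x + p y) = s]
   pointwise, of the part of the triangle above that line, followed by the
   exchange of the coordinates.  Below the line the truncated subtraction makes
   the shear trivial. *)
Definition mutation (k p p' s : nat) (x : nat * nat) : nat * nat :=
  let d := (k * (p' * x.1 + p * x.2) - s)%N in
  (x.2 + d * p', x.1 - d * p)%N.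

(** The form [k (p' m + p n)] is invariant once [p] and [p'] are exchanged, so the reverse mutation
    has the same [d] and undoes the shear. As [c = k p p' - 1], the bound [c m + k p^2 n <= p s]
    reads [p (k (p' m + p n) - s) <= m]. *)
Lemma mutation_spec (k p p' c s : nat) (x : nat * nat) :
  (k * p * p' = c.+1)%N -> under_line c (k * p ^ 2) (p * s) x ->
  under_line c (k * p' ^ 2) (p' * s) (mutation k p p' s x) /\
  mutation k p' p s (mutation k p p' s x) = x.
Proof.
case: x => m n kpp'; rewrite /under_line /mutation /= => h.
set d := (k * (p' * m + p * n) - s)%N.
(* The source inequality in this form: [m - d * p] is not truncated. *)
have pdm : (d * p <= m)%N by rewrite /d mulnBl; nia.
have E : (k * (p * (n + d * p') + p' * (m - d * p)) =
    k * (p' * m + p * n))%N.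
  by move: (d) pdm => e em; rewrite -{2}(subnK em); ring.
rewrite E -/d !addnK subnK//; split => //.
(* The target inequality in the same form, where it is immediate. *)
have : (p' * d <= n + d * p')%N by nia.
have : (k * (p' * m + p * n) <= s + d)%N by rewrite /d; lia.
nia.
Qed.

Lemma card_under_line_mutation (k p p' c s : nat) :
  (k * p * p' = c.+1)%N ->
  under_line c (k * p ^ 2) (p * s) #= under_line c (k * p' ^ 2) (p' * s).
Proof.
move=> e; have e' : (k * p' * p = c.+1)%N by rewrite -e mulnAC.
apply/card_set_bijP; exists (mutation k p p' s).
split=> [x /(mutation_spec _ _ _ _ _ _ e)[] //||x].
  move=> x y; rewrite !inE => /(mutation_spec _ _ _ _ _ _ e)[_ xK].
  by move=> /(mutation_spec _ _ _ _ _ _ e)[_ yK] xy; rewrite -xK xy.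
move=> /(mutation_spec _ _ _ _ _ _ e')[mx xK].
by exists (mutation k p' p s x).
Qed.

Lemma card_under_lineC (a b s : nat) : under_line a b s #= under_line b a s.
Proof.
apply/card_set_bijP; exists (fun x => (x.2, x.1)).
split=> [[m n]|[m n] [m' n'] _ _ [-> ->] //|[m n] h].
  by rewrite /under_line /= addnC.
by exists (n, m) => //; move: h; rewrite /under_line /= addnC.
Qed.

(** The half-turn of the rectangle [[0, b s] x [0, a s]] swaps the parts [A] and [B] on either side
    of the diagonal. They overlap in the diagonal, whose lattice points are the [s + 1] points
    [(b i, a (s - i))] by coprimality; inclusion-exclusion concludes. *)
Lemma card_under_line_rectangle (a b s : nat) :
  (0 < a)%N -> (0 < b)%N -> coprime a b ->
  (2 * #|` fset_set (under_line a b (a * b * s))|%fset =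
   (a * s).+1 * (b * s).+1 + s.+1)%N.
Proof.
move=> a0 b0 ab.
pose T := ('I_(b * s).+1 * 'I_(a * s).+1)%type.
pose A := [set x : T | (a * x.1 + b * x.2 <= a * b * s)%N]%SET.
pose B := [set x : T | (a * b * s <= a * x.1 + b * x.2)%N]%SET.
have -> : #|` fset_set (under_line a b (a * b * s))|%fset = #|A|.
  pose f (x : T) := (x.1 : nat, x.2 : nat).
  have -> : fset_set (under_line a b (a * b * s)) = [fset f x | x in A]%fset.
    apply/fsetP => -[m n]; rewrite in_fset_set; last exact: finite_under_line.
    apply/idP/imfsetP => [|[x xA ->]]; rewrite !inE /under_line /=.
      move=> h.
      have mb : (m < (b * s).+1)%N by rewrite ltnS -(leq_pmul2l a0); lia.
      have na : (n < (a * s).+1)%N by rewrite ltnS -(leq_pmul2l b0); lia.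
      by exists (Ordinal mb, Ordinal na); rewrite ?inE.
    by move: xA; rewrite inE.
  rewrite card_in_imfset /=; first by rewrite cardE.
  by move=> [m n] [m' n'] _ _ [/val_inj -> /val_inj ->].
have BA : #|B| = #|A|.
  pose g (x : T) : T := (rev_ord x.1, rev_ord x.2).
  have gK : involutive g by case=> m n; rewrite /g !rev_ordK.
  have -> : B = g @^-1: A.
    apply/setP => -[m n]; rewrite !inE /= !subSS.
    have := ltn_ord m; rewrite ltnS -(leq_pmul2l a0) => am.
    have := ltn_ord n; rewrite ltnS -(leq_pmul2l b0) => bn.
    by rewrite !mulnBr; lia.
  by rewrite on_card_preimset//; exists g => ? _; exact: gK.
have AB : #|A :&: B| = s.+1.
  have h (i : 'I_s.+1) : (b * i < (b * s).+1)%N /\ (a * (s - i) < (a * s).+1)%N.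
    by rewrite !ltnS !leq_mul2l leq_subr -ltnS ltn_ord !orbT.
  pose d (i : 'I_s.+1) : T := (Ordinal (h i).1, Ordinal (h i).2).
  have dinj : injective d.
    move=> i j [/eqP]; rewrite eqn_pmul2l// => /eqP ij _; exact: val_inj.
  rewrite -[RHS]card_ord -(card_codom dinj); apply: eq_card => -[m n].
  rewrite !inE /= -eqn_leq; apply/eqP/codomP => [e|[i [-> ->]] /=]; last first.
    have := ltn_ord i; rewrite ltnS => /subnKC si; rewrite -[in RHS]si; ring.
  have /dvdnP[i mi] : (b %| m)%N.
    rewrite -(@Gauss_dvdr _ a) 1?coprime_sym//.
    rewrite -(dvdn_addl _ (dvdn_mulr n (dvdnn b))) e.
    by rewrite mulnAC dvdn_mull.
  have si : (i < s.+1)%N.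
    by have := ltn_ord m; rewrite mi mulnC !ltnS leq_pmul2l.
  exists (Ordinal si); congr pair; apply: val_inj => /=.
    by rewrite mi mulnC.
  apply/eqP; rewrite -(eqn_pmul2l b0) -(eqn_add2l (a * m)) e mi.
  by apply/eqP; rewrite mulnBr mulnBr; nia.
have U : A :|: B = [set: T]%SET.
  by apply/setP => x; rewrite !inE leq_total.
have := cardsUI A B; rewrite U AB BA cardsT card_prod !card_ord.
by lia.
Qed.

Lemma card_under_line_descent (k l p q t : nat) :
  (k, l) \in [:: (1, 1); (2, 1); (3, 2)]%N ->
  (k * p ^ 2 + l * q ^ 2 + 1 = (k + l + 1) * (p * q))%N ->
  under_line (l * q ^ 2) (k * p ^ 2) (t * (p * q)) #= under_line l k t.
Proof.
move=> hkl; have [n] := ubnP (p + q); elim: n p q => // n IH p q pqn e.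
have p0 : (0 < p)%N by case: p e {pqn} => //; lia.
have q0 : (0 < q)%N by case: q e {pqn} => //; lia.
(* [p'] is the other root of the equation seen as a quadratic in [p]; [k] divides [k + l + 1] in all
   three cases. *)
have [p' hp'] : exists p', (k * (p + p') = (k + l + 1) * q)%N.
  have : (k * p < (k + l + 1) * q)%N by rewrite -(ltn_pmul2r p0); nia.
  move: hkl; rewrite !inE => /or3P[] /eqP[-> ->] h.
  - by exists (3 * q - p)%N; lia.
  - by exists (2 * q - p)%N; lia.
  - by exists (2 * q - p)%N; lia.
have [q' hq'] : exists q', (l * (q + q') = (k + l + 1) * p)%N.
  have : (l * q < (k + l + 1) * p)%N by rewrite -(ltn_pmul2r q0); nia.
  move: hkl; rewrite !inE => /or3P[] /eqP[-> ->] h.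
  - by exists (3 * p - q)%N; lia.
  - by exists (4 * p - q)%N; lia.
  - by exists (3 * p - q)%N; lia.
(* The products of the roots are what the mutation requires. *)
have pp' : (k * p * p' = (l * q ^ 2).+1)%N by nia.
have qq' : (l * q * q' = (k * p ^ 2).+1)%N by nia.
have [lt_p|le_p] := ltnP p' p.
  rewrite [(t * _)%N](_ : _ = p * (t * q))%N; last by lia.
  apply: (card_eq_trans (card_under_line_mutation _ _ _ _ _ pp')).
  rewrite [(p' * _)%N](_ : _ = t * (p' * q))%N; last by lia.
  apply: IH; first by lia.
  by nia.
have [lt_q|le_q] := ltnP q' q.
  (* Exchanging coordinates before and after lets the mutation act on [q]. *)
  apply: (card_eq_trans (card_under_lineC _ _ _)).
  rewrite [(t * _)%N](_ : _ = q * (t * p))%N; last by lia.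
  apply: (card_eq_trans (card_under_line_mutation _ _ _ _ _ qq')).
  apply: (card_eq_trans (card_under_lineC _ _ _)).
  rewrite [(q' * _)%N](_ : _ = t * (p * q'))%N; last by lia.
  apply: IH; first by lia.
  by nia.
(* When neither move decreases, [k p^2] and [l q^2] differ by at most 1. *)
have kp : (k * p ^ 2 <= (l * q ^ 2).+1)%N by rewrite -pp'; nia.
have lq : (l * q ^ 2 <= (k * p ^ 2).+1)%N by rewrite -qq'; nia.
suff [-> ->] : p = 1%N /\ q = 1%N by rewrite !muln1; exact: card_eqxx.
clear -hkl p0 q0 e kp lq; move: hkl; rewrite !inE.
move=> /or3P[] /eqP[? ?]; subst k l.
- have pq : p = q by nia.
  by subst q; nia.
(* Bounding [l q^2] by [k p^2 + 1] in the equation gives [q <= p] after rounding; the other bound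
   then gives [p^2 <= 1]. *)
- have : (p * q <= p * p)%N by lia.
  rewrite leq_pmul2l// => qp; have : (p ^ 2 <= 1)%N by nia.
  nia.
- have : (p * q <= p * p)%N by lia.
  rewrite leq_pmul2l// => qp; have : (p ^ 2 <= 1)%N by nia.
  nia.
Qed.

Theorem theorem1p2 (R : realType) (k l p q : nat)
  (hkl : (k, l) \in [:: (1, 1); (2, 1); (3, 2)]%N)
  (hp : (0 < p)%N) (hq : (0 < q)%N) (hpq : coprime (k * p) (l * q)) :
  ehrhart_equivalent
    (right_triangle (q%:R / (k%:R * p%:R) : R) (p%:R / (l%:R * q%:R)))
    (right_triangle (1 / k%:R) (1 / l%:R)) <->
  k%:Z * p%:Z ^+ 2 - (k%:Z + l%:Z + 1) * p%:Z * q%:Z + l%:Z * q%:Z ^+ 2 + 1 = 0.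
Proof.
have [k0 l0] : (0 < k)%N /\ (0 < l)%N.
  by move: hkl; rewrite !inE => /or3P[] /eqP[-> ->].
have [ckl cklpq] : coprime k l /\ coprime (k * p ^ 2) (l * q ^ 2).
  move: hpq; rewrite -!mulnn !(coprimeMl, coprimeMr).
  by move=> /andP[/andP[-> ->] /andP[-> ->]].
have n0 (n : nat) : (0 < n)%N -> n%:R != 0 :> R by rewrite pnatr_eq0 -lt0n.
have EL t : (0 < t)%N -> ehrhart
    (right_triangle (q%:R / (k%:R * p%:R) : R) (p%:R / (l%:R * q%:R))) t =
    #|` fset_set (under_line (l * q ^ 2) (k * p ^ 2) (t * (p * q)))|%fset.
  (* With [s = t p q], the legs [s / (t k p^2)] and [s / (t l q^2)] simplify to the given ones. *)
  move=> t0; rewrite -(@ehrhart_right_triangle R _ _ _ t)//;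
    rewrite ?muln_gt0 ?expn_gt0 ?t0 ?k0 ?l0 ?hp ?hq//.
  by congr (ehrhart (right_triangle _ _) t); rewrite !natrM;
    field; rewrite !n0.
have ER t : (0 < t)%N -> ehrhart (right_triangle (1 / k%:R : R) (1 / l%:R)) t =
    #|` fset_set (under_line l k t)|%fset.
  move=> t0; rewrite -(@ehrhart_right_triangle R _ _ _ t)//.
  by congr (ehrhart (right_triangle _ _) t); rewrite !natrM; field; rewrite !n0.
have -> : k%:Z * p%:Z ^+ 2 - (k%:Z + l%:Z + 1) * p%:Z * q%:Z +
    l%:Z * q%:Z ^+ 2 + 1 = 0 <->
    (k * p ^ 2 + l * q ^ 2 + 1 = (k + l + 1) * (p * q))%N.
  split; lia.
split=> [EE|e t t0]; last first.
  rewrite EL// ER//; apply/fcard_eq; last exact: card_under_line_descent.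
    by apply: finite_under_line; rewrite muln_gt0 expn_gt0 ?k0 ?l0 ?hp ?hq.
  exact: finite_under_line.
(* At this [t] the rectangle count applies to both sides, with [s = 1] on the left and [s = p q] on
   the right; the terms [k l p^2 q^2] cancel, leaving the equation. *)
have t0 : (0 < k * l * (p * q))%N by rewrite !muln_gt0 k0 l0 hp hq.
have := EE _ t0; rewrite EL// ER// => /(congr1 (muln 2)).
have -> : (k * l * (p * q) * (p * q) = (l * q ^ 2) * (k * p ^ 2) * 1)%N by lia.
have -> : (k * l * (p * q) = l * k * (p * q))%N by lia.
rewrite !card_under_line_rectangle ?muln_gt0 ?expn_gt0 ?k0 ?l0 ?hp ?hq//.
- lia.
- by rewrite coprime_sym.
- by rewrite coprime_sym.
Qed.
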